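(* Let $k$ be a field, let $1\le m\le\infty$, let $\mathcal{T}$ be a $\mathbb{Z}/m$-graded triangulated category, and let $R$ be a (commutative) finite type $k$-algebra acting centrally on $\mathcal{T}$. Suppose that there exists a (split-)generator $G\in\mathcal{T}$ such that $\operatorname{Hom}_{\mathcal{T}}^\bullet(G,G)$ is a Noetherian $R$-module. Then $$\operatorname{Rdim}\mathcal{T}\ \ge\ \dim_R\operatorname{Hom}_{\mathcal{T}}^\bullet(G,G).$$
   Context: Let $\mathcal{T}$ be a triangulated category with shift functor $\Sigma$. $\mathcal{T}$ is $\mathbb{Z}/m$-graded for finite $m$ if $\Sigma^m=\mathrm{id}$; for $m=\infty$ one sets $\mathbb{Z}/\infty:=\mathbb{Z}$ and there is no condition. $\operatorname{Hom}^\bullet_{\mathcal{T}}(X,Y):=\bigoplus_{i=1}^m\operatorname{Hom}_{\mathcal{T}}(X,\Sigma^iY)$ for $m<\infty$ and $\bigoplus_{i\in\mathbb{Z}}\operatorname{Hom}_{\mathcal{T}}(X,\Sigma^iY)$ for $m=\infty$. The graded center $Z^\bullet(\mathcal{T})=\bigoplus_d Z^d(\mathcal{T})$ is the graded-commutative ring with $Z^d(\mathcal{T})$ the set of natural transformations $\eta:\mathrm{id}\to\Sigma^d$ satisfying $\eta\Sigma=(-1)^d\Sigma\eta$. A central action of a graded-commutative ring $R$ on $\mathcal{T}$ is a morphism of graded-commutative rings $R\to Z^\bullet(\mathcal{T})$; each $\operatorname{Hom}^\bullet_{\mathcal{T}}(X,Y)$ then becomes an $R$-module. An ungraded commutative ring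 $R$ is regarded as concentrated in degree $0$. For a finitely generated $R$-module $M$, $\dim_R M:=\dim(R/\operatorname{Ann}_R(M))$ (Krull dimension). For $G\in\mathcal{T}$ put $\langle G\rangle_0=0$; let $\langle G\rangle=\langle G\rangle_1$ be the smallest strictly full subcategory containing $G$ and closed under finite direct sums, shifts and direct summands; inductively let $\langle G\rangle_n$ be the smallest strictly full subcategory closed under finite direct sums, shifts and summands containing every $K$ in a distinguished triangle $K_0\to K\to K_1\to$ with $K_0\in\langle G\rangle_{n-1}$, $K_1\in\langle G\rangle$. $G$ is a (split-)generator if $\mathcal{T}=\bigcup_n\langle G\rangle_n$. $\operatorname{Rdim}\mathcal{T}\in\mathbb{Z}_{\ge-1}\cup\{\infty\}$ is the smallest $n$ with $\mathcal{T}=\langle G\rangle_{n+1}$ for some object $G$. *)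

(* Defs.v *)
From HB Require Import structures.
From mathcomp Require Import all_boot all_order all_algebra.
From mathcomp Require Import boolp classical_sets functions cardinality constructive_ereal.

Set Implicit Arguments.
Unset Strict Implicit.
Unset Printing Implicit Defensive.

Import Order.TTheory GRing.Theory Num.Theory.

Local Open Scope classical_set_scope.
Local Open Scope ring_scope.

Local Obligation Tactic := idtac.

Record preadditive := Preadditive {
  obj :> Type;
  hom : obj -> obj -> zmodType;
  idm : forall X, hom X X;
  comp : forall X Y Z, hom Y Z -> hom X Y -> hom X Z;
  compA : forall X Y Z W (h : hom Z W) (g : hom Y Z) (f : hom X Y),
    comp h (comp g f) = comp (comp h g) f;
  comp1m : forall X Y (f : hom X Y), comp (idm Y) f = f;
  compm1 : forall X Y (f : hom X Y), comp f (idm X) = f;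
  compDl : forall X Y Z (g g' : hom Y Z) (f : hom X Y),
    comp (g + g') f = comp g f + comp g' f;
  compDr : forall X Y Z (g : hom Y Z) (f f' : hom X Y),
    comp g (f + f') = comp g f + comp g f'
}.
Arguments hom {_} _ _.
Arguments idm {_} _.

Declare Scope cat_scope.
Delimit Scope cat_scope with cat.
Local Open Scope cat_scope.
Notation "g ∘ f" := (comp g f) (at level 40, left associativity) : cat_scope.

Section Preadditive.
Variable C : preadditive.
Implicit Types X Y Z : C.

Definition is_iso X Y (f : hom X Y) :=
  exists g : hom Y X, g ∘ f = idm X /\ f ∘ g = idm Y.

Definition isomorphic X Y := exists f : hom X Y, is_iso f.

Definition is_zero_obj X := idm X = 0.

Definition is_biproduct X Y B :=
  exists (i1 : hom X B) (i2 : hom Y B) (p1 : hom B X) (p2 : hom B Y),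
    [/\ p1 ∘ i1 = idm X, p2 ∘ i2 = idm Y, p1 ∘ i2 = 0, p2 ∘ i1 = 0
      & i1 ∘ p1 + i2 ∘ p2 = idm B].

End Preadditive.

Record functor (C D : preadditive) := Functor {
  fobj :> C -> D;
  fmap : forall X Y : C, hom X Y -> hom (fobj X) (fobj Y);
  fmap1 : forall X, fmap (idm X) = idm (fobj X);
  fmapM : forall X Y Z (g : hom Y Z) (f : hom X Y),
    fmap (g ∘ f) = fmap g ∘ fmap f;
  fmapD : forall X Y (f g : hom X Y), fmap (f + g) = fmap f + fmap g
}.
Arguments fmap {C D} _ {X Y} _.

Definition functor_id (C : preadditive) : functor C C :=
  @Functor C C id (fun _ _ => id) (fun _ => erefl) (fun _ _ _ _ _ => erefl)
    (fun _ _ _ _ => erefl).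

Section FunctorComp.
Variables (C D E : preadditive) (G : functor D E) (F : functor C D).

Let gf X Y (f : hom X Y) := fmap G (fmap F f).

Lemma functor_comp1 X : gf (idm X) = idm (G (F X)).
Proof. by rewrite /gf !fmap1. Qed.

Lemma functor_compM X Y Z (g : hom Y Z) (f : hom X Y) :
  gf (g ∘ f) = gf g ∘ gf f.
Proof. by rewrite /gf !fmapM. Qed.

Lemma functor_compD X Y (f g : hom X Y) : gf (f + g) = gf f + gf g.
Proof. by rewrite /gf !fmapD. Qed.

Definition functor_comp : functor C E :=
  Functor functor_comp1 functor_compM functor_compD.

End FunctorComp.

Definition naturally_isomorphic (C D : preadditive) (F G : functor C D) :=
  exists eta : forall X, hom (F X) (G X),
    (forall X Y (f : hom X Y), eta Y ∘ fmap F f = fmap G f ∘ eta X) /\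
    (forall X, is_iso (eta X)).

(** The shift is an auto-equivalence [shift] with a chosen quasi-inverse
    [unshift]; an automorphism is the case where the latter is its inverse. *)
Record triangulated := Triangulated {
  tcat :> preadditive;
  zero_obj_ex : exists X : tcat, is_zero_obj X;
  biproduct_ex : forall X Y : tcat, exists B, is_biproduct X Y B;
  shift : functor tcat tcat;
  unshift : functor tcat tcat;
  shiftK :
    naturally_isomorphic (functor_comp unshift shift) (functor_id tcat);
  unshiftK :
    naturally_isomorphic (functor_comp shift unshift) (functor_id tcat);
  dist : forall X Y Z : tcat, hom X Y -> hom Y Z -> hom Z (shift X) -> Prop;
  dist_iso : forall X Y Z X' Y' Z' (f : hom X Y) (g : hom Y Z)
      (h : hom Z (shift X)) (f' : hom X' Y') (g' : hom Y' Z')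
      (h' : hom Z' (shift X')) (a : hom X X') (b : hom Y Y') (c : hom Z Z'),
    is_iso a -> is_iso b -> is_iso c ->
    b ∘ f = f' ∘ a -> c ∘ g = g' ∘ b -> fmap shift a ∘ h = h' ∘ c ->
    dist f g h -> dist f' g' h';
  dist_id : forall X Z : tcat, is_zero_obj Z ->
    dist (idm X) (0 : hom X Z) (0 : hom Z (shift X));
  dist_cone : forall X Y (f : hom X Y),
    exists Z (g : hom Y Z) (h : hom Z (shift X)), dist f g h;
  dist_rotate : forall X Y Z (f : hom X Y) (g : hom Y Z) (h : hom Z (shift X)),
    dist f g h <-> dist g h (- fmap shift f);
  dist_morphism : forall X Y Z X' Y' Z' (f : hom X Y) (g : hom Y Z)
      (h : hom Z (shift X)) (f' : hom X' Y') (g' : hom Y' Z')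
      (h' : hom Z' (shift X')) (a : hom X X') (b : hom Y Y'),
    dist f g h -> dist f' g' h' -> b ∘ f = f' ∘ a ->
    exists c : hom Z Z', c ∘ g = g' ∘ b /\ fmap shift a ∘ h = h' ∘ c;
  dist_octahedron : forall X Y Z X' Y' Z' (f : hom X Y) (g : hom Y Z)
      (f1 : hom Y Z') (f2 : hom Z' (shift X))
      (g1 : hom Z X') (g2 : hom X' (shift Y))
      (h1 : hom Z Y') (h2 : hom Y' (shift X)),
    dist f f1 f2 -> dist g g1 g2 -> dist (g ∘ f) h1 h2 ->
    exists (u : hom Z' Y') (v : hom Y' X'),
      [/\ dist u v (fmap shift f1 ∘ g2), u ∘ f1 = h1 ∘ g, h2 ∘ u = f2,
          v ∘ h1 = g1 & g2 ∘ v = fmap shift f ∘ h2]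
}.
Arguments shift {_}.
Arguments unshift {_}.
Arguments dist {_ X Y Z} _ _ _.

(** A grading parameter [1 <= m <= oo] is an [option nat], with [None] for
    [m = oo]. *)
Definition grading_pos (m : option nat) :=
  if m is Some n then (0 < n)%N else true.

(** [Σ^m = id] is equality of functors, on objects and on morphisms. *)
Definition Zmod_graded (m : option nat) (T : triangulated) : Prop :=
  if m is Some n
  then iter n (functor_comp (@shift T)) (functor_id T) = functor_id T
  else True.

Definition shiftz (T : triangulated) (i : int) (X : T) : T :=
  match i with
  | Posz n => iter n (@shift T) X
  | Negz n => iter n.+1 (@unshift T) X
  end.

(** For [d = 0] the condition [η Σ = (-1)^d Σ η] has no sign. *)
Record center0 (T : triangulated) := Center0 {
  center_val :> forall X : T, hom X X;
  center_nat : forall X Y (f : hom X Y),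
    center_val Y ∘ f = f ∘ center_val X;
  center_shift : forall X, center_val (shift X) = fmap shift (center_val X)
}.

Section PreadditiveTheory.
Variable C : preadditive.
Implicit Types X Y Z : C.

Lemma comp0m X Y Z (f : hom X Y) : (0 : hom Y Z) ∘ f = 0.
Proof. by apply: (addIr ((0 : hom Y Z) ∘ f)); rewrite -compDl !add0r. Qed.

Lemma compm0 X Y Z (f : hom Y Z) : f ∘ (0 : hom X Y) = 0.
Proof. by apply: (addIr (f ∘ (0 : hom X Y))); rewrite -compDr !add0r. Qed.

Lemma compNm X Y Z (g : hom Y Z) (f : hom X Y) : (- g) ∘ f = - (g ∘ f).
Proof. by apply: (addIr (g ∘ f)); rewrite -compDl !addNr comp0m. Qed.

Lemma compmN X Y Z (g : hom Y Z) (f : hom X Y) : g ∘ (- f) = - (g ∘ f).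
Proof. by apply: (addIr (g ∘ f)); rewrite -compDr !addNr compm0. Qed.

Lemma fmap0 (D : preadditive) (F : functor C D) X Y :
  fmap F (0 : hom X Y) = 0.
Proof. by apply: (addIr (fmap F (0 : hom X Y))); rewrite -fmapD !add0r. Qed.

Lemma fmapN (D : preadditive) (F : functor C D) X Y (f : hom X Y) :
  fmap F (- f) = - fmap F f.
Proof. by apply: (addIr (fmap F f)); rewrite -fmapD !addNr fmap0. Qed.

End PreadditiveTheory.

Section CenterRing.
Variable T : triangulated.
Implicit Types a b c : center0 T.

Lemma center_ext a b : (forall X, a X = b X) -> a = b.
Proof.
case: a b => [a an asf] [b bn bs] /= e.
have E : a = b by exact: functional_extensionality_dep.
by subst b; congr Center0; exact: Prop_irrelevance.
Qed.

HB.instance Definition _ := gen_eqMixin (center0 T).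
HB.instance Definition _ := gen_choiceMixin (center0 T).

Program Definition center_zero : center0 T := @Center0 T (fun X => 0) _ _.
Next Obligation. by move=> X Y f; rewrite comp0m compm0. Qed.
Next Obligation. by move=> X; rewrite fmap0. Qed.

Program Definition center_opp a : center0 T :=
  @Center0 T (fun X => - a X) _ _.
Next Obligation. by move=> a X Y f; rewrite compNm compmN center_nat. Qed.
Next Obligation. by move=> a X; rewrite fmapN center_shift. Qed.

Program Definition center_add a b : center0 T :=
  @Center0 T (fun X => a X + b X) _ _.
Next Obligation. by move=> a b X Y f; rewrite compDl compDr !center_nat. Qed.
Next Obligation. by move=> a b X; rewrite fmapD !center_shift. Qed.

Program Definition center_one : center0 T := @Center0 T (@idm T) _ _.
Next Obligation. by move=> X Y f; rewrite comp1m compm1. Qed.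
Next Obligation. by move=> X; rewrite fmap1. Qed.

Program Definition center_mul a b : center0 T :=
  @Center0 T (fun X => a X ∘ b X) _ _.
Next Obligation.
by move=> a b X Y f; rewrite -compA (center_nat b) compA (center_nat a) compA.
Qed.
Next Obligation. by move=> a b X; rewrite fmapM !center_shift. Qed.

Lemma center_addA : associative center_add.
Proof. by move=> a b c; apply: center_ext => X /=; rewrite addrA. Qed.
Lemma center_addC : commutative center_add.
Proof. by move=> a b; apply: center_ext => X /=; rewrite addrC. Qed.
Lemma center_add0 : left_id center_zero center_add.
Proof. by move=> a; apply: center_ext => X /=; rewrite add0r. Qed.
Lemma center_addN : left_inverse center_zero center_opp center_add.
Proof. by move=> a; apply: center_ext => X /=; rewrite addNr. Qed.

HB.instance Definition _ := GRing.isZmodule.Build (center0 T)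
  center_addA center_addC center_add0 center_addN.

Lemma center_mulA : associative center_mul.
Proof. by move=> a b c; apply: center_ext => X /=; rewrite compA. Qed.
Lemma center_mulC : commutative center_mul.
Proof. by move=> a b; apply: center_ext => X /=; rewrite center_nat. Qed.
Lemma center_mul1 : left_id center_one center_mul.
Proof. by move=> a; apply: center_ext => X /=; rewrite comp1m. Qed.
Lemma center_mulDl : left_distributive center_mul +%R.
Proof. by move=> a b c; apply: center_ext => X /=; rewrite compDl. Qed.

HB.instance Definition _ := GRing.Zmodule_isComPzRing.Build (center0 T)
  center_mulA center_mulC center_mul1 center_mulDl.

End CenterRing.

(** A morphism of graded rings from a ring concentrated in degree 0 to the
    graded center is a ring morphism to its degree-0 part. *)
Notation central_action R T := {rmorphism R -> center0 T}.

Definition degrees (m : option nat) : set int :=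
  [set i | if m is Some n then (1 <= i <= n%:Z)%R else true].

(** [⊕_i Hom(X, Σ^i Y)], over [1 <= i <= m] or over all of [int]; the families
    are indexed by [int], and vanish outside of [degrees m]. The action is an
    argument so that the R-module structure can be found by unification. *)
Record Homgr (R : comPzRingType) (T : triangulated) (act : central_action R T)
    (m : option nat) (X Y : T) := HomGr {
  homc :> forall i : int, hom X (shiftz i Y);
  homc_finite : finite_set [set i | homc i <> 0];
  homc_degrees : forall i, ~ degrees m i -> homc i = 0
}.

Section HomgrModule.
Variables (R : comPzRingType) (T : triangulated) (act : central_action R T).
Variables (m : option nat) (X Y : T).
Local Notation H := (Homgr act m X Y).
Implicit Types (f g h : H) (r s : R).

Lemma homc_ext f g : (forall i, f i = g i) -> f = g.
Proof.
case: f g => [f ff fd] [g gf gd] /= e.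
have E : f = g by exact: functional_extensionality_dep.
by subst g; congr HomGr; exact: Prop_irrelevance.
Qed.

HB.instance Definition _ := gen_eqMixin H.
HB.instance Definition _ := gen_choiceMixin H.

Program Definition homgr_zero : H := @HomGr _ _ _ _ _ _ (fun i => 0) _ _.
Next Obligation. by apply: (sub_finite_set _ (finite_set0 int)) => i /=. Qed.
Next Obligation. by []. Qed.

Program Definition homgr_opp f : H :=
  @HomGr _ _ _ _ _ _ (fun i => - f i) _ _.
Next Obligation.
move=> f; apply: (sub_finite_set _ (homc_finite f)) => i /= fi E.
by apply: fi; rewrite E oppr0.
Qed.
Next Obligation. by move=> f i mi /=; rewrite homc_degrees ?oppr0. Qed.

Program Definition homgr_add f g : H :=
  @HomGr _ _ _ _ _ _ (fun i => f i + g i) _ _.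
Next Obligation.
move=> f g; have fin : finite_set ([set i | f i <> 0] `|` [set i | g i <> 0]).
  by rewrite finite_setU; split; exact: homc_finite.
apply: (sub_finite_set _ fin) => i /= fgi.
by case: (pselect (f i = 0)) => fi; [right=> gi; apply: fgi; rewrite fi gi addr0|left].
Qed.
Next Obligation. by move=> f g i mi /=; rewrite !homc_degrees ?addr0. Qed.

Program Definition homgr_scale r f : H :=
  @HomGr _ _ _ _ _ _ (fun i => act r (shiftz i Y) ∘ f i) _ _.
Next Obligation.
move=> r f; apply: (sub_finite_set _ (homc_finite f)) => i /= fi E.
by apply: fi; rewrite E compm0.
Qed.
Next Obligation. by move=> r f i mi /=; rewrite homc_degrees ?compm0. Qed.

Lemma homgr_addA : associative homgr_add.
Proof. by move=> f g h; apply: homc_ext => i /=; rewrite addrA. Qed.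
Lemma homgr_addC : commutative homgr_add.
Proof. by move=> f g; apply: homc_ext => i /=; rewrite addrC. Qed.
Lemma homgr_add0 : left_id homgr_zero homgr_add.
Proof. by move=> f; apply: homc_ext => i /=; rewrite add0r. Qed.
Lemma homgr_addN : left_inverse homgr_zero homgr_opp homgr_add.
Proof. by move=> f; apply: homc_ext => i /=; rewrite addNr. Qed.

HB.instance Definition _ := GRing.isZmodule.Build H
  homgr_addA homgr_addC homgr_add0 homgr_addN.

Lemma homgr_scaleA r s f :
  homgr_scale r (homgr_scale s f) = homgr_scale (r * s) f.
Proof. by apply: homc_ext => i /=; rewrite rmorphM /= compA. Qed.
Lemma homgr_scale1 : left_id 1 homgr_scale.
Proof. by move=> f; apply: homc_ext => i /=; rewrite rmorph1 /= comp1m. Qed.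
Lemma homgr_scaleDr : right_distributive homgr_scale +%R.
Proof. by move=> r f g; apply: homc_ext => i /=; rewrite compDr. Qed.
Lemma homgr_scaleDl f : {morph homgr_scale^~ f : r s / r + s}.
Proof. by move=> r s; apply: homc_ext => i /=; rewrite rmorphD /= compDl. Qed.

HB.instance Definition _ := GRing.Zmodule_isLmodule.Build R H
  homgr_scaleA homgr_scale1 homgr_scaleDr homgr_scaleDl.

End HomgrModule.

(** A k-algebra is given by its structure morphism, so that the zero ring is
    allowed; no proper subalgebra contains the finitely many generators. *)
Definition finite_type (k : fieldType) (R : comPzRingType)
    (iota : {rmorphism k -> R}) : Prop :=
  exists s : seq R, forall S : {pred R}, subring_closed S ->
    (forall c, iota c \in S) -> {subset s <= S} -> forall r, r \in S.

Definition fg_submodule (R : pzRingType) (M : lmodType R) (N : {pred M}) :=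
  exists2 s : seq M, {subset s <= N} &
    forall x, x \in N -> exists c : nat -> R, x = \sum_(i < size s) c i *: s`_i.

Definition noetherian_module (R : pzRingType) (M : lmodType R) : Prop :=
  forall N : {pred M}, submod_closed N -> fg_submodule N.

(** [idealr] and [prime_idealr] from MathComp exclude the zero ring. *)
Definition prime_ideal (A : comPzRingType) (P : set A) : Prop :=
  [/\ P 0, ~ P 1, (forall a u v, P u -> P v -> P (a * u + v))
    & forall u v, P (u * v) -> P u \/ P v].

Definition prime_chain (A : comPzRingType) (n : nat) (p : nat -> set A) : Prop :=
  (forall i, (i <= n)%N -> prime_ideal (p i)) /\
  (forall i, (i < n)%N -> p i `<` p i.+1).

(** The Krull dimension of the zero ring is [-oo]. *)
Definition krull_dim (A : comPzRingType) : \bar int :=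
  supremum -oo%E [set (n%:Z)%:E | n in [set n | exists p, @prime_chain A n p]].

Definition annihilator (R : comPzRingType) (M : lmodType R) : {pred R} :=
  fun r => `[< forall x : M, r *: x = 0 >].

Section AnnihilatorQuotient.
Variables (R : comPzRingType) (M : lmodType R).

Lemma annihilatorP r :
  reflect (forall x : M, r *: x = 0) (r \in annihilator M).
Proof. exact: asboolP. Qed.

Lemma annihilator_zmod_closed : zmod_closed (annihilator M).
Proof.
split=> [|r s /annihilatorP rM /annihilatorP sM]; apply/annihilatorP => x.
  by rewrite scale0r.
by rewrite scalerBl rM sM subrr.
Qed.

HB.instance Definition _ :=
  GRing.isZmodClosed.Build R (annihilator M) annihilator_zmod_closed.

Lemma annihilatorMl a r : r \in annihilator M -> a * r \in annihilator M.
Proof.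
by move=> /annihilatorP rM; apply/annihilatorP => x; rewrite -scalerA rM scaler0.
Qed.

Local Open Scope quotient_scope.

(** MathComp puts a ring structure on quotients by proper ideals of nonzero
    rings only, while the annihilator is the whole ring if [M] is zero. *)
Definition annihilator_quot := Quotient.quot (annihilator M).
Local Notation Q := annihilator_quot.

HB.instance Definition _ := GRing.Zmodule.on Q.
HB.instance Definition _ := EqQuotient.on Q.

Definition quot_one : Q := \pi_Q 1.
Definition quot_mul (x y : Q) : Q := \pi_Q (repr x * repr y).

Lemma quot_piP (r s : R) : r - s \in annihilator M -> \pi_Q r = \pi_Q s.
Proof. by move=> rs; apply/eqP; rewrite -Quotient.idealrBE. Qed.

Lemma quot_repr_pi r : repr (\pi_Q r) - r \in annihilator M.
Proof. by rewrite Quotient.idealrBE reprK. Qed.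

Lemma quot_mul_pi r s : quot_mul (\pi_Q r) (\pi_Q s) = \pi_Q (r * s).
Proof.
apply: quot_piP; set r' := repr _; set s' := repr _.
have -> : r' * s' - r * s = r' * (s' - s) + s * (r' - r).
  by rewrite !mulrBr addrA [r' * s]mulrC subrK [s * r]mulrC.
by apply: rpredD; apply/annihilatorMl/quot_repr_pi.
Qed.

Lemma quot_mulA : associative quot_mul.
Proof.
elim/quotW=> x; elim/quotW=> y; elim/quotW=> z.
by rewrite (quot_mul_pi y z) (quot_mul_pi x y) !quot_mul_pi mulrA.
Qed.
Lemma quot_mulC : commutative quot_mul.
Proof. by elim/quotW=> x; elim/quotW=> y; rewrite !quot_mul_pi mulrC. Qed.
Lemma quot_mul1 : left_id quot_one quot_mul.
Proof. by elim/quotW=> x; rewrite quot_mul_pi mul1r. Qed.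
Lemma quot_mulDl : left_distributive quot_mul +%R.
Proof.
have piD r s : \pi_Q (r + s) = \pi_Q r + \pi_Q s by exact: Quotient.pi_add.
elim/quotW=> x; elim/quotW=> y; elim/quotW=> z.
by rewrite -piD !quot_mul_pi mulrDl piD.
Qed.

HB.instance Definition _ := GRing.Zmodule_isComPzRing.Build Q
  quot_mulA quot_mulC quot_mul1 quot_mulDl.

End AnnihilatorQuotient.

Definition module_dim (R : comPzRingType) (M : lmodType R) : \bar int :=
  krull_dim (annihilator_quot M).

Section Generation.
Variable T : triangulated.

(** The smallest strictly full subcategory containing [S] and closed under
    finite direct sums, shifts and direct summands. *)
Inductive add_closure (S : T -> Prop) : T -> Prop :=
  | add_base X : S X -> add_closure S X
  | add_iso X Y : isomorphic X Y -> add_closure S X -> add_closure S Y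
  | add_zero X : is_zero_obj X -> add_closure S X
  | add_sum X Y B : is_biproduct X Y B ->
      add_closure S X -> add_closure S Y -> add_closure S B
  | add_shift X : add_closure S X -> add_closure S (shift X)
  | add_unshift X : add_closure S X -> add_closure S (unshift X)
  | add_summand X Y B : is_biproduct X Y B ->
      add_closure S B -> add_closure S X.

Definition gen1 (G : T) : T -> Prop := add_closure (fun X => X = G).

Definition extension (S S' : T -> Prop) (K : T) : Prop :=
  exists (K0 K1 : T) (f : hom K0 K) (g : hom K K1) (h : hom K1 (shift K0)),
    [/\ S K0, S' K1 & dist f g h].

Fixpoint gen (G : T) (n : nat) : T -> Prop :=
  match n with
  | 0 => @is_zero_obj T
  | 1 => gen1 G
  | n'.+1 => add_closure (extension (gen G n') (gen1 G))
  end.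

Definition is_generator (G : T) : Prop := forall X, exists n, gen G n X.

Definition generated_in (n : nat) : Prop := exists G, forall X, gen G n X.

(** The index [n] of [ex_minn] stands for [T = <G>_n], whence the shift by 1. *)
Definition Rdim : \bar int :=
  match pselect (exists n, `[< generated_in n >]) with
  | left ex => ((ex_minn ex)%:Z - 1)%:E
  | right _ => +oo%E
  end.

End Generation.

(* Main.v *)
From HB Require Import structures.
From mathcomp Require Import all_boot all_order all_algebra.
From mathcomp Require Import boolp classical_sets cardinality.
From mathcomp Require Import constructive_ereal.
Require Import Defs.

(** Fix an object [G'] with [T = <G'>_n], and call a map [f : X -> Y] a coghost
    if [v ∘ f = 0] for every [v] from [Y] to an object of [<G'>_1]. The
    composite of [n] coghosts is killed by every map from its target to an
    object of [<G'>_n] ([coghost_lemma]). As every object lies in [<G'>_n], a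
    composite of [n] coghosts is zero. So it suffices to build, from a chain
    [p_0 < p_1 < ... < p_d] of primes containing the annihilator of the graded
    Hom module of [G], which is that of [id_G], a nonzero composite of [d]
    coghosts: this gives [d < n].

    The composite is a tower of maps [f_i : G -> K_i], where [K_0 = G] and
    [f_0 = id], and the invariant is that the annihilator of [f_i] is contained
    in [p_i]; in particular [f_i] is not zero. For the step choose [x] in
    [p_(i+1)] but not in [p_i], let [K_(i+1)] be the cone of
    [x^(2N) : K_i -> K_i], with its map [q : K_i -> K_(i+1)], and put
    [f_(i+1) = q ∘ x^N ∘ f_i]. Two facts hold for large [N].
    - The map [q ∘ x^N] is a coghost ([koszul_coghost]). Indeed, for
      [v : K_(i+1) -> Z] the map [v ∘ q] is killed by [x^(2N)], hence by [x^N]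
      as soon as [N] bounds the exponents of the [x]-power torsion of
      [Hom(K_i, Z)].
    - The annihilator of [f_(i+1)] is contained in [p_(i+1)]
      ([annihilator_koszul_class]). Since the kernel of composition with [q] on
      [Hom(G, K_i)] is [x^(2N) Hom(G, K_i)], the question is which elements kill
      the class of [x^N f_i] in [M / x^(2N) M], with [M = Hom(G, K_i)]. This is
      commutative algebra, of Artin-Rees type, over the module [M].

    Both facts rest on ascending chain conditions for [Hom(X, Y)], for
    arbitrary [X] and [Y]. They follow from the one for [Hom(G, G)] by devissage
    along the construction of [T] from [G] ([hom_devissage]). The bound [N] of
    the first fact has to be uniform over all shifts of [K_i]: for finite [m]
    there are only [m] shifts up to isomorphism, and for infinite [m] all but
    finitely many of the groups [Hom(Σ^j X, Y)] vanish, again by devissage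
    ([uniform_torsion_bound]). *)

Set Implicit Arguments.
Unset Strict Implicit.
Unset Printing Implicit Defensive.

Import Order.TTheory GRing.Theory Num.Theory.
Local Open Scope ring_scope.
Local Open Scope cat_scope.

(** * Isomorphisms and the shift functor *)

Section Preadditive.
Variable C : preadditive.
Implicit Types X Y Z W : C.

Lemma isomorphic_refl X : isomorphic X X.
Proof. by exists (idm X); exists (idm X); rewrite comp1m. Qed.

Lemma isomorphic_sym X Y : isomorphic X Y -> isomorphic Y X.
Proof. by move=> [f [g [gf fg]]]; exists g; exists f. Qed.

Lemma isomorphic_trans X Y Z :
  isomorphic X Y -> isomorphic Y Z -> isomorphic X Z.
Proof.
move=> [f [f' [f'f ff']]] [g [g' [g'g gg']]]; exists (g ∘ f), (f' ∘ g').
by split; rewrite -compA [X in _ ∘ X]compA ?g'g ?ff' comp1m.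
Qed.

Lemma isomorphic_fmap (F : functor C C) X Y :
  isomorphic X Y -> isomorphic (F X) (F Y).
Proof.
move=> [f [g [gf fg]]]; exists (fmap F f), (fmap F g).
by rewrite -!fmapM gf fg !fmap1.
Qed.

Lemma hom_to_zero X Y (f : hom X Y) : is_zero_obj Y -> f = 0.
Proof. by move=> Y0; rewrite -[f]comp1m Y0 comp0m. Qed.

Lemma hom_from_zero X Y (f : hom X Y) : is_zero_obj X -> f = 0.
Proof. by move=> X0; rewrite -[f]compm1 X0 compm0. Qed.

Lemma zero_obj_fmap (F : functor C C) X : is_zero_obj X -> is_zero_obj (F X).
Proof. by move=> X0; rewrite /is_zero_obj -fmap1 X0 fmap0. Qed.

(** Naturality recovers [h] from [F h] by conjugating with the isomorphism. *)
Lemma nat_iso_id_faithful (F : functor C C) X Y (f g : hom X Y) :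
  naturally_isomorphic F (functor_id C) -> fmap F f = fmap F g -> f = g.
Proof.
move=> [eta [nat iso]] Ffg; have [e [_ etaK]] := iso X.
have E (h : hom X Y) : h = eta Y ∘ fmap F h ∘ e.
  by rewrite nat -compA etaK compm1.
by rewrite (E f) (E g) Ffg.
Qed.

End Preadditive.

Section Shift.
Variable T : triangulated.
Implicit Types X Y Z W : T.

Lemma unshift_shift X : isomorphic (unshift (shift X)) X.
Proof. by have [eta [_ iso]] := shiftK T; exists (eta X); exact: iso. Qed.

Lemma shift_unshift X : isomorphic (shift (unshift X)) X.
Proof. by have [eta [_ iso]] := unshiftK T; exists (eta X); exact: iso. Qed.

Lemma shift_faithful X Y (f g : hom X Y) :
  fmap shift f = fmap shift g -> f = g.
Proof.
by move=> fg; apply: (nat_iso_id_faithful (shiftK T)); rewrite /= fg.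
Qed.

Lemma unshift_faithful X Y (f g : hom X Y) :
  fmap unshift f = fmap unshift g -> f = g.
Proof.
by move=> fg; apply: (nat_iso_id_faithful (unshiftK T)); rewrite /= fg.
Qed.

(** Carry [unshift g] back along [unshift ∘ shift = id]. The result [f]
    satisfies [shift f = g] because [unshift] cannot tell them apart. *)
Lemma shift_full X Y (g : hom (shift X) (shift Y)) :
  exists f : hom X Y, fmap shift f = g.
Proof.
have [eta [nat iso]] := shiftK T.
have [e [eetaX etaeX]] := iso X; have [e' [eetaY etaeY]] := iso Y.
exists (eta Y ∘ fmap unshift g ∘ e); apply: unshift_faithful.
set f := eta Y ∘ _ ∘ _; have /= := nat _ _ f => E.
rewrite -[LHS]comp1m -[X in X ∘ _]eetaY -compA E /f !compA eetaY comp1m.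
by rewrite -compA eetaX compm1.
Qed.

(** In negative degrees this is only an isomorphism, because [unshift] is a mere
    quasi-inverse of [shift]. *)
Lemma shift_shiftz j X : isomorphic (shift (shiftz j X)) (shiftz (j + 1) X).
Proof.
case: j => [n|[|n]].
- by rewrite -PoszD addn1; exact: isomorphic_refl.
- exact: shift_unshift.
- have -> : Negz n.+1 + 1 = Negz n.
    by rewrite !NegzE -[n.+2]addn1 PoszD opprD subrK.
  exact: (shift_unshift (shiftz (Negz n) X)).
Qed.

Lemma iter_shift_shiftz n j X :
  isomorphic (iter n (@shift T) (shiftz j X)) (shiftz (j + n%:Z) X).
Proof.
elim: n => [|n IHn]; first by rewrite addr0; exact: isomorphic_refl.
apply: isomorphic_trans (isomorphic_fmap _ IHn) _.
by rewrite -addn1 PoszD addrA; exact: shift_shiftz.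
Qed.

Lemma iter_shift_id n X :
  Zmod_graded (Some n) T -> iter n (@shift T) X = X.
Proof.
move=> /(congr1 (fun F : functor T T => F X)) /= E; rewrite -{2}E.
by elim: n {E} => //= n ->.
Qed.

Lemma shiftz_periodic n j X : Zmod_graded (Some n) T ->
  isomorphic (shiftz j X) (shiftz (j + n%:Z) X).
Proof.
by move=> Tn; have := iter_shift_shiftz n j X; rewrite iter_shift_id.
Qed.

Lemma shiftz_mod n j X : (0 < n)%N -> Zmod_graded (Some n) T ->
  exists2 i : nat, (i < n)%N & isomorphic (shiftz j X) (shiftz i.+1%:Z X).
Proof.
move=> n0 Tn.
have per (k : nat) i : isomorphic (shiftz i X) (shiftz (i + (k * n)%:Z) X).
  elim: k => [|k IHk]; first by rewrite addr0; exact: isomorphic_refl.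
  apply: isomorphic_trans IHk _; rewrite mulSn addnC PoszD addrA.
  exact: shiftz_periodic.
have n0' : n%:Z != 0 by rewrite eqz_nat -lt0n.
exists `|((j - 1) %% n%:Z)%Z|%N.
  by rewrite -ltz_nat gez0_abs ?modz_ge0 // ltz_pmod.
have -> : `|((j - 1) %% n%:Z)%Z|.+1%:Z = ((j - 1) %% n%:Z)%Z + 1 :> int.
  by rewrite -addn1 PoszD gez0_abs ?modz_ge0.
have {1}-> : j = ((j - 1) %/ n%:Z)%Z * n%:Z + (((j - 1) %% n%:Z)%Z + 1).
  by rewrite addrA -divz_eq subrK.
move: (_ %% _)%Z => r; case: ((j - 1) %/ n%:Z)%Z => q.
  by rewrite addrC -PoszM; apply/isomorphic_sym/per.
have := per q.+1 (Negz q * n%:Z + (r + 1)).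
by rewrite PoszM NegzE mulNr [X in _ (_ X _)]addrAC addNr add0r.
Qed.

End Shift.

(** * Long exact sequences of a triangle *)

Section Triangles.
Variable T : triangulated.
Implicit Types X Y Z W : T.

(** Compare with the triangle on the identity of [X], whose third object is
    zero. *)
Lemma dist_comp0 X Y Z (f : hom X Y) (g : hom Y Z) (h : hom Z (shift X)) :
  dist f g h -> g ∘ f = 0.
Proof.
move=> fgh; have [Z0 Z00] := zero_obj_ex T.
have [c [<- _]] := dist_morphism (dist_id X Z00) fgh (erefl (f ∘ idm X)).
exact: compm0.
Qed.

(** A lift of [u] is, after one shift, the third component of a morphism from
    the triangle [W -> 0 -> Σ W] to the rotated triangle. *)
Lemma dist_lift X Y Z W (f : hom X Y) (g : hom Y Z) (h : hom Z (shift X))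
    (u : hom W Y) :
  dist f g h -> g ∘ u = 0 -> exists v : hom W X, u = f ∘ v.
Proof.
move=> /dist_rotate fgh gu0; have [Z0 Z00] := zero_obj_ex T.
have /dist_rotate idW := dist_id W Z00.
have [|c [_ Ec]] := @dist_morphism _ _ _ _ _ _ _ _ _ _ _ _ _ u 0 idW fgh.
  by rewrite comp0m gu0.
have [v Ev] := shift_full c; exists v; apply: shift_faithful.
move: Ec; rewrite fmap1 compmN compm1 compNm => /oppr_inj ->.
by rewrite fmapM Ev.
Qed.

(** The factorization is the third component of a morphism to the triangle
    [0 -> W -> W]. *)
Lemma dist_desc X Y Z W (f : hom X Y) (g : hom Y Z) (h : hom Z (shift X))
    (u : hom Y W) :
  dist f g h -> u ∘ f = 0 -> exists v : hom Z W, u = v ∘ g.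
Proof.
move=> fgh uf0; have [Z0 Z00] := zero_obj_ex T.
have idW : dist (0 : hom Z0 W) (idm W) (0 : hom W (shift Z0)).
  by apply/dist_rotate; rewrite fmap0 oppr0; apply/dist_id/zero_obj_fmap.
have [|c [Ec _]] := @dist_morphism _ _ _ _ _ _ _ _ _ _ _ _ _ 0 u fgh idW.
  by rewrite uf0 comp0m.
by exists c; rewrite Ec comp1m.
Qed.

End Triangles.

(** * Induction over generated subcategories *)

Section ThickInduction.
Variable T : triangulated.
Implicit Types (X Y Z : T) (P S : T -> Prop).

(** Closure under isomorphisms and under summands are both instances of closure
    under retracts. *)
Record add_stable P : Prop := AddStable {
  stable_zero : forall X, is_zero_obj X -> P X;
  stable_retract : forall X Y (i : hom X Y) (p : hom Y X),
    p ∘ i = idm X -> P Y -> P X;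
  stable_sum : forall X Y B, is_biproduct X Y B -> P X -> P Y -> P B;
  stable_shift : forall X, P X -> P (shift X);
  stable_unshift : forall X, P X -> P (unshift X)
}.

Lemma add_closure_min S P : add_stable P -> (forall X, S X -> P X) ->
  forall X, add_closure S X -> P X.
Proof.
move=> stP SP X.
elim=> {X} [X /SP //|X Y [f [g [_ fg]]] _ PX|X|X Y B XYB _ PX _ PY|X _|X _|].
- exact: stable_retract fg PX.
- exact: stable_zero.
- exact: stable_sum XYB PX PY.
- exact: stable_shift.
- exact: stable_unshift.
- by move=> X Y B [i [_ [p [_ [pi _ _ _ _]]]]] _; exact: stable_retract pi.
Qed.

Lemma gen_min G P : add_stable P -> P G ->
  (forall X0 X X1 (f : hom X0 X) (g : hom X X1) (h : hom X1 (shift X0)),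
     dist f g h -> P X0 -> P X1 -> P X) ->
  forall n X, gen G n X -> P X.
Proof.
move=> stP PG Pext; have P1 : forall X, gen1 G X -> P X.
  by apply: add_closure_min => // X ->.
elim=> [|[|n] IHn]; [exact: stable_zero|exact: P1|].
apply: add_closure_min => // X [X0 [X1 [f [g [h [/IHn PX0 /P1 PX1 fgh]]]]]].
exact: Pext fgh PX0 PX1.
Qed.

End ThickInduction.

(** * Devissage of properties of Hom groups *)

Section Devissage.
Variable T : triangulated.
Implicit Types X Y Z : T.

(** [Phi X Y] is meant as a property of the group [Hom(X, Y)]. An additive class
    has enough closure to pass from [G] to [<G>_1] in the target. *)
Record hom_additive_class (Phi : T -> T -> Prop) : Prop := HomAdditiveClass {
  hom_class_zero : forall X Y, (forall u : hom X Y, u = 0) -> Phi X Y;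
  hom_class_shift : forall X Y, Phi X Y <-> Phi (shift X) (shift Y);
  hom_class_retract_target : forall X Y Y' (i : hom Y' Y) (p : hom Y Y'),
    p ∘ i = idm Y' -> Phi X Y -> Phi X Y';
  hom_class_retract_source : forall X X' Y (i : hom X' X) (p : hom X X'),
    p ∘ i = idm X' -> Phi X Y -> Phi X' Y;
  hom_class_sum_target : forall X Y Y' B,
    is_biproduct Y Y' B -> Phi X Y -> Phi X Y' -> Phi X B
}.

(** The property passes to the middle term of an exact sequence
    [Hom(X, Y0) -> Hom(X, Y) -> Hom(X, Y1)], and likewise in the source. *)
Record hom_serre_class (Phi : T -> T -> Prop) : Prop := HomSerreClass {
  serre_zero : forall X Y, (forall u : hom X Y, u = 0) -> Phi X Y;
  serre_shift : forall X Y, Phi X Y <-> Phi (shift X) (shift Y);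
  serre_target : forall X Y0 Y Y1 (f : hom Y0 Y) (g : hom Y Y1),
    (forall u : hom X Y, g ∘ u = 0 -> exists v, u = f ∘ v) ->
    Phi X Y0 -> Phi X Y1 -> Phi X Y;
  serre_source : forall X0 X X1 Y (f : hom X0 X) (g : hom X X1),
    (forall u : hom X Y, u ∘ f = 0 -> exists v, u = v ∘ g) ->
    Phi X0 Y -> Phi X1 Y -> Phi X Y
}.

(** Retracts and sums give exact sequences of Hom groups: for a retract, one
    whose second map is zero. *)
Lemma serre_additive Phi : hom_serre_class Phi -> hom_additive_class Phi.
Proof.
move=> serrePhi.
split=> [||X Y Y' i p pi XY|X X' Y i p pi XY|X Y Y' B
  [i1 [i2 [p1 [p2 [_ _ _ _ ip]]]]]].
- exact: serre_zero serrePhi.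
- exact: serre_shift serrePhi.
- apply: (serre_target serrePhi (f := p) (g := (0 : hom Y' Y))) => // u _.
  by exists (i ∘ u); rewrite compA pi comp1m.
- apply: (serre_source serrePhi (f := (0 : hom X X')) (g := i)) => // u _.
  by exists (u ∘ p); rewrite -compA pi compm1.
- apply: (serre_target serrePhi (f := i1) (g := p2)) => u p2u; exists (p1 ∘ u).
  by rewrite -[LHS]comp1m -ip compDl -!compA p2u compm0 addr0.
Qed.

(** A filter of sets of degrees stable under the symmetries of [int] states that
    a property of the shifts holds in nearly all degrees. *)
Record translation_filter (E : (int -> Prop) -> Prop) : Prop :=
    TranslationFilter {
  filter_true : E (fun=> True);
  filter_imp2 : forall D1 D2 D : int -> Prop,
    (forall j, D1 j -> D2 j -> D j) -> E D1 -> E D2 -> E D;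
  filter_translate : forall (n : int) D, E D -> E (fun j => D (j + n));
  filter_opp : forall D, E D -> E (fun j => D (- j))
}.

Lemma translation_filter_all : translation_filter (fun D => forall j, D j).
Proof. by split=> // D1 D2 D D12 ED1 ED2 j; exact: D12. Qed.

Lemma translation_filter_cobounded :
  translation_filter (fun D => exists b : nat, forall j, b%:Z <= `|j| -> D j).
Proof.
split=> [|D1 D2 D D12 [b1 D1b] [b2 D2b]|n D [b Db]|D [b Db]].
- by exists 0%N.
- exists (b1 + b2)%N => j bj; apply: D12.
    by apply: D1b; apply: le_trans bj; rewrite lez_nat leq_addr.
  by apply: D2b; apply: le_trans bj; rewrite lez_nat leq_addl.
- exists (b + `|n|)%N => j bj; apply: Db; rewrite -(lerD2r `|n|).
  apply: le_trans (ler_normB (j + n) n) => //.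
  by rewrite addrK; apply: le_trans bj; rewrite PoszD abszE.
- by exists b => j bj; apply: Db; rewrite normrN.
Qed.

Section AdditiveClass.
Variables (Phi : T -> T -> Prop) (addPhi : hom_additive_class Phi).

Lemma hom_class_iso X X' Y Y' :
  isomorphic X X' -> isomorphic Y Y' -> Phi X Y -> Phi X' Y'.
Proof.
move=> [f [f' [_ ff']]] [g [g' [_ gg']]] XY.
apply: (hom_class_retract_target addPhi) gg' _.
exact: (hom_class_retract_source addPhi) ff' XY.
Qed.

Lemma hom_class_shift_iso X X' Y Y' :
  isomorphic (shift X) X' -> isomorphic (shift Y) Y' -> Phi X Y <-> Phi X' Y'.
Proof.
move=> XX' YY'; split=> [/(hom_class_shift addPhi)|XY].
  exact: hom_class_iso.
apply/(hom_class_shift addPhi).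
by apply: hom_class_iso XY; apply: isomorphic_sym.
Qed.

(** Shifting source and target simultaneously [j] times turns [Hom(Σ^-j X, Y)]
    into [Hom(X, Σ^j Y)]. *)
Lemma hom_class_shiftz_adjoint X Y j :
  Phi X (shiftz j Y) -> Phi (shiftz (- j) X) Y.
Proof.
have step i k : Phi (shiftz k X) (shiftz i Y) <->
                Phi (shiftz (k + 1) X) (shiftz (i + 1) Y).
  by apply: hom_class_shift_iso; exact: shift_shiftz.
suff: Phi (shiftz 0 X) (shiftz j Y) <-> Phi (shiftz (- j) X) (shiftz 0 Y).
  by move=> H /H.
have steps (n : nat) i k : Phi (shiftz k X) (shiftz i Y) <->
                Phi (shiftz (k + n%:Z) X) (shiftz (i + n%:Z) Y).
  elim: n => [|n IHn]; first by rewrite !addr0.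
  by rewrite IHn step -!addrA -PoszD addn1.
case: j => n; first by rewrite (steps n 0 (- n%:Z)) addNr add0r.
by rewrite NegzE opprK (steps n.+1 (- n.+1%:Z) 0) addNr add0r.
Qed.

Lemma filter_mono E (D D' : int -> Prop) : translation_filter E ->
  (forall j, D j -> D' j) -> E D -> E D'.
Proof.
by move=> fE DD' ED; apply: (filter_imp2 fE) ED (filter_true fE) => j /DD'.
Qed.

Lemma filter_all E (D : int -> Prop) :
  translation_filter E -> (forall j, D j) -> E D.
Proof. by move=> fE ?; apply: (filter_mono fE) (filter_true fE). Qed.

(** A shift of [Y] is absorbed by a translation of the degrees [j], which the
    filter allows. *)
Lemma hom_class_target_stable E X : translation_filter E ->
  add_stable (fun Y => E (fun j => Phi (shiftz j X) Y)).
Proof.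
move=> fE; split=> [Y Y0|Y Y' i p pi|Y Y' B YY'B|Y EY|Y EY].
- apply: (filter_all fE) => j; apply: (hom_class_zero addPhi) => u.
  exact: hom_to_zero.
- by apply: (filter_mono fE) => j; exact: (hom_class_retract_target addPhi) pi.
- by apply: (filter_imp2 fE) => j; exact: (hom_class_sum_target addPhi).
- apply: (filter_mono fE) (filter_translate fE (-1) EY) => j.
  have := shift_shiftz (j - 1) X; rewrite subrK => jX.
  exact: (hom_class_shift_iso jX (isomorphic_refl _)).1.
- apply: (filter_mono fE) (filter_translate fE 1 EY) => j.
  exact: (hom_class_shift_iso (shift_shiftz j X) (shift_unshift Y)).2.
Qed.

End AdditiveClass.

(** First [X] runs over the category with target the shifts of [G], then [Y]
    with source the shifts of [X]; moving the shift from the target to the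
    source in between means that triangles are never shifted. *)
Theorem hom_devissage Phi E G : hom_serre_class Phi -> translation_filter E ->
  is_generator G -> E (fun j => Phi G (shiftz j G)) ->
  forall X Y, E (fun j => Phi (shiftz j X) Y).
Proof.
move=> serrePhi fE genG EG X Y; have addPhi := serre_additive serrePhi.
have EX : E (fun j => Phi X (shiftz j G)).
  have [n] := genG X; move: n X; apply: gen_min => //; last first.
    move=> X0 X X1 f g h fgh; apply: (filter_imp2 fE) => j.
    apply: (serre_source serrePhi (f := f) (g := g)) => u.
    exact: (dist_desc fgh).
  split=> [X X0|X X' i p pi|X X' B [i1 [i2 [p1 [p2 [_ _ _ _ ip]]]]]|X EX|X EX].
  - apply: (filter_all fE) => j; apply: (serre_zero serrePhi) => u.
    exact: hom_from_zero.
  - apply: (filter_mono fE) => j.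
    exact: (hom_class_retract_source addPhi) pi.
  - apply: (filter_imp2 fE) => j.
    apply: (serre_source serrePhi (f := i1) (g := p2)) => u ui1.
    by exists (u ∘ i2); rewrite -[LHS]compm1 -ip compDr !compA ui1 comp0m add0r.
  - apply: (filter_mono fE) (filter_translate fE (-1) EX) => j.
    have := shift_shiftz (j - 1) G; rewrite subrK => jG.
    exact: (hom_class_shift_iso addPhi (isomorphic_refl _) jG).1.
  - apply: (filter_mono fE) (filter_translate fE 1 EX) => j.
    exact: (hom_class_shift_iso addPhi (shift_unshift X) (shift_shiftz j G)).2.
have [n] := genG Y; move: n Y; apply: gen_min.
- exact: (hom_class_target_stable addPhi X fE).
- apply: (filter_mono fE) (filter_opp fE EX) => j.
  by move=> /(hom_class_shiftz_adjoint addPhi); rewrite opprK.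
- move=> Y0 Y Y1 f g h fgh; apply: (filter_imp2 fE) => j.
  apply: (serre_target serrePhi (f := f) (g := g)) => u.
  exact: (dist_lift fgh).
Qed.

End Devissage.

(** * The coghost lemma *)

Section Coghosts.
Variables (T : triangulated) (G : T).
Implicit Types X Y Z : T.

Definition coghost X Y (f : hom X Y) : Prop :=
  forall Z (v : hom Y Z), gen1 G Z -> v ∘ f = 0.

(** The [n]-th power of the ideal of coghosts, all maps for [n = 0]. *)
Fixpoint coghosts n X Y (f : hom X Y) : Prop :=
  if n is n'.+1 then
    exists W (a : hom X W) (b : hom W Y),
      [/\ f = b ∘ a, coghosts n' a & coghost b]
  else True.

Lemma coghost_shift X Y (f : hom X Y) : coghost f -> coghost (fmap shift f).
Proof.
move=> fG Z v Zgen; have [e [e' [e'e _]]] := isomorphic_sym (shift_unshift Z).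
have [w Ew] := shift_full (e ∘ v).
rewrite -[_ ∘ _]comp1m -e'e -compA [e ∘ _]compA -Ew -fmapM fG ?fmap0 ?compm0 //.
exact: add_unshift.
Qed.

Lemma coghost_unshift X Y (f : hom X Y) :
  coghost f -> coghost (fmap unshift f).
Proof.
move=> fG Z v Zgen; apply: shift_faithful; rewrite fmap0 fmapM.
have [eta [nat iso]] := unshiftK T.
have [e [eK Ke]] := iso X; have [e' [e'K Ke']] := iso Y.
have -> : fmap shift (fmap unshift f) = e' ∘ (f ∘ eta X).
  by rewrite -nat compA e'K comp1m.
by rewrite !compA (fG _ (_ ∘ e')) ?comp0m //; exact: add_shift.
Qed.

Lemma coghosts_shift n X Y (f : hom X Y) :
  coghosts n f -> coghosts n (fmap shift f).
Proof.
elim: n X Y f => //= n IHn X Y _ [W [a [b [-> /IHn an /coghost_shift bG]]]].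
by exists (shift W), (fmap shift a), (fmap shift b); rewrite fmapM.
Qed.

Lemma coghosts_unshift n X Y (f : hom X Y) :
  coghosts n f -> coghosts n (fmap unshift f).
Proof.
elim: n X Y f => //= n IHn X Y _ [W [a [b [-> /IHn an /coghost_unshift bG]]]].
by exists (unshift W), (fmap unshift a), (fmap unshift b); rewrite fmapM.
Qed.

(** For a shift of [K] move the shift to [f], where it preserves coghosts. *)
Lemma coghosts_killed_stable n : add_stable (fun K : T =>
  forall X Y (f : hom X Y) (u : hom Y K), coghosts n f -> u ∘ f = 0).
Proof.
split=> [K K0|K L i p pi LP|K L B [i1 [i2 [p1 [p2 [_ _ _ _ ip]]]]] KP LP
  |K KP|K KP] X Y f u fn.
- by rewrite (hom_to_zero u K0) comp0m.
- by rewrite -[LHS]comp1m -pi -compA [i ∘ _]compA LP ?compm0.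
- rewrite -[LHS]comp1m -ip compDl -!compA [p1 ∘ _]compA [p2 ∘ _]compA.
  by rewrite KP ?LP // !compm0 addr0.
- have [e [e' [e'e _]]] := unshift_shift K.
  apply: unshift_faithful; rewrite fmap0 fmapM -[LHS]comp1m -e'e -compA.
  by rewrite [e ∘ _]compA (KP _ _ _ _ (coghosts_unshift fn)) compm0.
- have [e [e' [e'e _]]] := shift_unshift K.
  apply: shift_faithful; rewrite fmap0 fmapM -[LHS]comp1m -e'e -compA.
  by rewrite [e ∘ _]compA (KP _ _ _ _ (coghosts_shift fn)) compm0.
Qed.

(** Let [K] be an extension of [K1] in [<G>_1] by [K0] in [<G>_n]. The last
    coghost kills the component of [u] in [K1], so what remains factors through
    [K0] and is killed by the first [n] coghosts. *)
Lemma coghost_lemma n K X Y (f : hom X Y) (u : hom Y K) :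
  gen G n K -> coghosts n f -> u ∘ f = 0.
Proof.
elim: n K X Y f u => [|n IHn] K X Y f u Kgen fn.
  by rewrite (hom_to_zero u Kgen) comp0m.
case: n IHn Kgen fn => [|n] IHn Kgen fn.
  by case: fn => [W [a [b [-> _ bG]]]]; rewrite compA bG ?comp0m.
move: K Kgen X Y f u fn; apply: add_closure_min.
  exact: coghosts_killed_stable.
move=> K [K0 [K1 [f [g [h [K0n K1G fgh]]]]]] X Y _ u [W [a [b [-> an bG]]]].
have [|v Ev] := dist_lift (u := u ∘ b) fgh; first by rewrite compA bG.
by rewrite compA Ev -compA (IHn K0) ?compm0.
Qed.

End Coghosts.

(** * Ascending chain conditions and the algebraic core *)

Section AscendingChains.
Variable R : comPzRingType.
Implicit Types M A B C : lmodType R.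

Definition submodule M (S : M -> Prop) : Prop :=
  S 0 /\ forall a u v, S u -> S v -> S (a *: u + v).

Definition acc M : Prop := forall N : nat -> M -> Prop,
  (forall t, submodule (N t)) -> (forall t u, N t u -> N t.+1 u) ->
  exists t, forall l u, N l u -> N t u.

Lemma chain_le M (N : nat -> M -> Prop) : (forall t u, N t u -> N t.+1 u) ->
  forall s t u, (s <= t)%N -> N s u -> N t u.
Proof.
move=> NS s t u; elim: t => [|t IHt]; first by rewrite leqn0 => /eqP ->.
by rewrite leq_eqVlt => /predU1P[-> //|]; rewrite ltnS => /IHt Nt /Nt /NS.
Qed.

Lemma submoduleB M (S : M -> Prop) u v : submodule S -> S u -> S v -> S (u - v).
Proof. by move=> [_ SD] Su Sv; rewrite addrC -scaleN1r; exact: SD. Qed.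

Lemma submoduleD M (S : M -> Prop) u v : submodule S -> S u -> S v -> S (u + v).
Proof. by move=> [_ SD] Su Sv; rewrite -[u]scale1r; exact: SD. Qed.

Lemma noetherian_acc M : noetherian_module M -> acc M.
Proof.
move=> noeM N Nsub NS; have Nle := chain_le NS.
pose U := [pred u : M | `[< exists t, N t u >]].
have [|s sU gen_s] := noeM U.
  split=> [|a u v /asboolP[t1 Nu] /asboolP[t2 Nv]]; apply/asboolP.
    by exists 0%N; case: (Nsub 0%N).
  exists (maxn t1 t2); apply: (Nsub _).2.
    exact: Nle (leq_maxl _ _) Nu.
  exact: Nle (leq_maxr _ _) Nv.
have [t st] : exists t, forall u, u \in s -> N t u.
  elim: s sU {gen_s} => [|v s IHs] sU; first by exists 0%N.
  have [u su|t1 st1] := IHs; first by apply: sU; rewrite inE su orbT.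
  have /asboolP[t2 vt2] := sU v (mem_head _ _).
  exists (maxn t1 t2) => u /predU1P[->|/st1].
    exact: Nle (leq_maxr _ _) vt2.
  exact: Nle (leq_maxl _ _).
exists t => l u Nu; have [|c ->] := gen_s u; first by apply/asboolP; exists l.
have [N0 ND] := Nsub t; apply: big_ind => // [x y|i _]; first exact: submoduleD.
by rewrite -[_ *: _]addr0; apply: ND => //; apply: st; rewrite mem_nth.
Qed.

(** A chain in [B] is determined by its preimage in [A] and its image in [C]
    once these have become stationary. *)
Lemma acc_exact A B C (f : A -> B) (g : B -> C) : linear f -> linear g ->
  (forall b, g b = 0 -> exists a, b = f a) -> acc A -> acc C -> acc B.
Proof.
move=> flin glin fg accA accC N Nsub NS; have Nle := chain_le NS.
have gB b b' : g (b - b') = g b - g b'.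
  by rewrite addrC -scaleN1r glin scaleN1r addrC.
have lin0 M M' (h : M -> M') : linear h -> h 0 = 0.
  by move=> hlin; have := hlin (-1) 0 0; rewrite !scaleN1r !addNr.
have [t1 t1P] : exists t, forall l a, N l (f a) -> N t (f a).
  apply: (accA (fun t a => N t (f a))) => [t|t a]; last exact: NS.
  split=> [|r u v Nu Nv]; first by rewrite lin0 //; case: (Nsub t).
  by rewrite flin; exact: (Nsub t).2.
have [t2 t2P] : exists t, forall l c, (exists2 b, N l b & c = g b) ->
                                      (exists2 b, N t b & c = g b).
  apply: (accC (fun t c => exists2 b, N t b & c = g b)) => [t|t c [b /NS]].
    split=> [|r _ _ [u Nu ->] [v Nv ->]].
      by exists 0; [case: (Nsub t)|rewrite lin0].
    by exists (r *: u + v); [exact: (Nsub t).2|rewrite glin].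
  by exists b.
exists (maxn t1 t2) => l u Nu.
have [|v Nv gv] := t2P l (g u); first by exists u.
have [|a Ea] := fg (u - v); first by rewrite gB gv subrr.
rewrite -(subrK v u); apply: submoduleD => //; last first.
  exact: Nle (leq_maxr _ _) Nv.
rewrite Ea; apply: (Nle _ _ _ (leq_maxl _ _)).
apply: (t1P (maxn l t2)); rewrite -Ea.
apply: submoduleB => //; first exact: Nle (leq_maxl _ _) Nu.
exact: Nle (leq_maxr _ _) Nv.
Qed.

(** Stabilization of the [x]-power torsion of [M / R c]. *)
Lemma acc_power_saturation M (c : M) (x : R) : acc M ->
  exists t : nat, forall l m, (exists r, x ^+ l *: m = r *: c) ->
                              (exists r, x ^+ t *: m = r *: c).
Proof.
move=> accM; apply: (accM (fun t m => exists r, x ^+ t *: m = r *: c)).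
  move=> t; split=> [|a u v [r Er] [s Es]].
    by exists 0; rewrite scaler0 scale0r.
  exists (a * r + s).
  by rewrite scalerDr scalerA mulrC -scalerA Er Es scalerDl scalerA.
by move=> t u [r Er]; exists (x * r); rewrite exprS -scalerA Er scalerA.
Qed.

(** If [s] kills the class of [x^N c] in [M / x^(2N) M], then [s x^N c] is
    [x^(2N) m], where [m] lies in the [x]-power saturation of [R c]. So
    [x^t m = r c] with [t] independent of [N]. For [N > t] write [x^N] as
    [x y x^t]; then [x^N (s - x y r)] annihilates [c]. By primality [s - x y r]
    lies in [p], hence [s] lies in [q], as [x] does. *)
Lemma annihilator_koszul_class M (c : M) (p q : set R) (x : R) : acc M ->
  prime_ideal p -> prime_ideal q -> (p `<=` q)%classic -> q x -> ~ p x ->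
  (forall r, r *: c = 0 -> p r) ->
  exists t : nat, forall N, (t < N)%N -> forall s m,
    s *: (x ^+ N *: c) = x ^+ (N + N) *: m -> q s.
Proof.
move=> accM [_ p1 _ pM] [_ _ qD _] pq qx px cp.
have pX k : ~ p (x ^+ k).
  by elim: k => [|k IHk]; rewrite ?expr0 ?exprS // => /pM[].
have [t tP] := acc_power_saturation c x accM; exists t => N tN s m Em.
have [|r Er] := tP (N + N)%N m.
  by exists (s * x ^+ N); rewrite -scalerA Em.
pose y := x ^+ (N - t.+1); have xN : x ^+ N = x * y * x ^+ t.
  by rewrite -exprS -exprD addSnnS subnK.
have Hs : (x ^+ N * (s - x * y * r)) *: c = 0.
  rewrite mulrBr scalerBl [_ * s]mulrC -[(s * _) *: c]scalerA Em.
  by rewrite exprD {2}xN mulrA -scalerA Er scalerA !mulrA subrr.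
have /pM[/pX //|/pq qs] : p (x ^+ N * (s - x * y * r)) by exact: cp.
rewrite (_ : s = (y * r) * x + (s - x * y * r)); first exact: qD.
by rewrite [_ * x]mulrC mulrA addrC subrK.
Qed.

End AscendingChains.

(** * Hom groups as modules *)

Section HomModules.
Variables (R : comPzRingType) (T : triangulated) (act : central_action R T).
Implicit Types (X Y Z : T) (r s x : R).

(** An alias of [hom] that carries the action, so that the module structure can
    be found by unification. *)
Definition hom_mod (act : central_action R T) X Y : Type := hom X Y.
Local Notation H := (hom_mod act).

HB.instance Definition _ X Y := GRing.Zmodule.copy (H X Y) (hom X Y).

Definition hom_scale X Y r (f : H X Y) : H X Y := act r Y ∘ f.

Lemma hom_scaleA X Y r s (f : H X Y) :
  hom_scale r (hom_scale s f) = hom_scale (r * s) f.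
Proof. by rewrite /hom_scale rmorphM /= compA. Qed.
Lemma hom_scale1 X Y : left_id 1 (@hom_scale X Y).
Proof. by move=> f; rewrite /hom_scale rmorph1 /= comp1m. Qed.
Lemma hom_scaleDr X Y : right_distributive (@hom_scale X Y) +%R.
Proof. by move=> r f g; rewrite /hom_scale -compDr. Qed.
Lemma hom_scaleDl X Y (f : H X Y) : {morph (@hom_scale X Y)^~ f : r s / r + s}.
Proof. by move=> r s; rewrite /hom_scale rmorphD /= compDl. Qed.

HB.instance Definition _ X Y := GRing.Zmodule_isLmodule.Build R (H X Y)
  (@hom_scaleA X Y) (@hom_scale1 X Y) (@hom_scaleDr X Y) (@hom_scaleDl X Y).

Lemma comp_linear_r X Y Z (g : hom Y Z) :
  linear ((fun u => g ∘ u) : H X Y -> H X Z).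
Proof. by move=> r u v; rewrite compDr compA -center_nat -compA. Qed.

Lemma comp_linear_l X Y Z (f : hom X Y) :
  linear ((fun u => u ∘ f) : H Y Z -> H X Z).
Proof. by move=> r u v; rewrite compDl -compA. Qed.

Lemma shift_linear X Y :
  linear (fmap shift : H X Y -> H (shift X) (shift Y)).
Proof. by move=> r u v; rewrite fmapD fmapM -center_shift. Qed.

Lemma zero_linear (M M' : lmodType R) : linear (fun _ : M => 0 : M').
Proof. by move=> r u v; rewrite scaler0 addr0. Qed.

Lemma hom_acc_serre : hom_serre_class (fun X Y => acc (H X Y)).
Proof.
split=> [X Y XY0 N Nsub _|X Y|X Y0 Y Y1 f g fg|X0 X X1 Y f g fg].
- by exists 0%N => l u _; rewrite (XY0 u); case: (Nsub 0%N).
- split=> accXY.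
    apply: (acc_exact (@shift_linear X Y) (@zero_linear _ _)) (accXY) (accXY).
    by move=> u _; have [v <-] := shift_full u; exists v.
  apply: (acc_exact (@zero_linear _ _) (@shift_linear X Y)) (accXY) (accXY).
  by move=> u u0; exists 0; apply: shift_faithful; rewrite u0 fmap0.
- exact: acc_exact (@comp_linear_r X Y0 Y f) (@comp_linear_r X Y Y1 g) fg.
- move=> acc0 acc1.
  exact: acc_exact (@comp_linear_l X X1 Y g) (@comp_linear_l X0 X Y f) fg
    acc1 acc0.
Qed.

Lemma hom_zero_serre :
  hom_serre_class (fun X Y : T => forall u : hom X Y, u = 0).
Proof.
split=> [//|X Y|X Y0 Y Y1 f g fg v0 u0 u|X0 X X1 Y f g fg u0 v0 u].
- split=> XY0 u; last by apply: shift_faithful; rewrite fmap0.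
  by have [v <-] := shift_full u; rewrite (XY0 v) fmap0.
- by have [|v ->] := fg u; rewrite ?(v0 v) ?compm0.
- by have [|v ->] := fg u; rewrite ?(v0 v) ?comp0m.
Qed.

Section Homgr.
Variables (m : option nat) (X Y : T).
Local Notation Hgr := (Homgr act m X Y).

Lemma homgr_single i (f : hom X (shiftz i Y)) :
  degrees m i -> exists2 h : Hgr, h i = f & forall j, i <> j -> h j = 0.
Proof.
move=> mi; pose h j : hom X (shiftz j Y) :=
  if i =P j is ReflectT e then ecast j (hom X (shiftz j Y)) e f else 0.
have hN j : i <> j -> h j = 0 by rewrite /h; case: eqP.
have hfin : finite_set [set j | h j <> 0].
  apply: (sub_finite_set _ (finite_set1 i)) => j /= hj.
  by apply: contrapT => ji; apply: hj; apply: hN => ij; exact: ji.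
have hdeg j : ~ degrees m j -> h j = 0.
  by move=> mj; apply: hN => ij; apply: mj; rewrite -ij.
exists (HomGr act hfin hdeg) => //=; rewrite /h.
by case: eqP => // e; rewrite eq_axiomK.
Qed.

Lemma homc_linear i : linear ((fun h => h i) : Hgr -> H X (shiftz i Y)).
Proof. by []. Qed.

(** [Hom(X, Σ^i Y)] is a quotient of the graded Hom module. *)
Lemma homgr_acc i : noetherian_module Hgr -> degrees m i ->
  acc (H X (shiftz i Y)).
Proof.
move=> /noetherian_acc accH mi.
apply: (acc_exact (@homc_linear i) (@zero_linear _ _)) (accH) (accH) => u _.
by have [h <- _] := homgr_single u mi; exists h.
Qed.

End Homgr.

(** The families that vanish in all degrees of absolute value at least [t] form
    an ascending chain of submodules. If it is stationary from [b] on, a family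
    concentrated in one degree [j], with [b] at most [`|j|], is zero, for it
    belongs to the chain. *)
Lemma homgr_bounded X Y : noetherian_module (Homgr act None X Y) ->
  exists b : nat, forall j, b%:Z <= `|j| ->
    forall u : hom X (shiftz j Y), u = 0.
Proof.
move=> /noetherian_acc accH.
have [t|t h ht j tj|b bP] :=
  accH (fun t h => forall j, t%:Z <= `|j| -> h j = 0).
- split=> // a u v ut vt j tj.
  by rewrite homc_linear ut // vt // scaler0 addr0.
- by apply: ht; apply: le_trans tj; rewrite lez_nat.
exists b => j bj u; have [//|h <- hj] := @homgr_single None X Y j u.
apply: (bP `|j|.+1) => // k jk; apply: hj => jk'; move: jk.
by rewrite -jk' -abszE lez_nat ltnn.
Qed.

End HomModules.

(** * Uniform bounds on power torsion *)

Section TorsionBound.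
Variables (R : comPzRingType) (T : triangulated) (act : central_action R T).
Implicit Types (X Y Z : T) (r s x : R).
Local Notation H := (hom_mod act).

Definition torsion_bound x N X Y : Prop :=
  forall l (u : H X Y), x ^+ l *: u = 0 -> x ^+ N *: u = 0.

Lemma torsion_bound_additive x N : hom_additive_class (torsion_bound x N).
Proof.
have scale_r X Y Z r (g : hom Y Z) (u : H X Y) :
    r *: (g ∘ u : H X Z) = g ∘ (r *: u : H X Y).
  by rewrite /GRing.scale /= /hom_scale compA center_nat -compA.
have scale_l X Y Z r (f : hom X Y) (u : H Y Z) :
    r *: (u ∘ f : H X Z) = (r *: u : H Y Z) ∘ f.
  by rewrite /GRing.scale /= /hom_scale compA.
have scale_shift X Y r (u : H X Y) :
    r *: (fmap shift u : H (shift X) (shift Y)) = fmap shift (r *: u : H X Y).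
  by rewrite /GRing.scale /= /hom_scale fmapM center_shift.
split=> [X Y XY0 l u _|X Y|X Y Y' i p pi XY l u xu|X X' Y i p pi XY l u xu
  |X Y Y' B [i1 [i2 [p1 [p2 [_ _ _ _ ip]]]]] XY XY' l u xu].
- exact: XY0.
- split=> XY l u.
    have [v <-] := shift_full u; rewrite !scale_shift => xv.
    by rewrite (XY l) ?fmap0 //; apply: shift_faithful; rewrite xv fmap0.
  move=> xu; apply: shift_faithful; rewrite -scale_shift fmap0.
  by apply: (XY l); rewrite scale_shift xu fmap0.
- rewrite -[LHS]comp1m -pi -compA -scale_r (XY l) ?compm0 //.
  by rewrite scale_r xu compm0.
- rewrite -[LHS]compm1 -pi compA -scale_l (XY l) ?comp0m //.
  by rewrite scale_l xu comp0m.
- rewrite -[LHS]comp1m -ip compDl -!compA -[p1 ∘ _]scale_r -[p2 ∘ _]scale_r.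
  by rewrite (XY l) ?(XY' l) ?compm0 ?addr0 // scale_r xu compm0.
Qed.

Lemma acc_torsion_bound x X Y : acc (H X Y) -> exists N, torsion_bound x N X Y.
Proof.
move=> /(acc_power_saturation 0 x)[N NP]; exists N => l u xu.
have [|r ->] := NP l u; last by rewrite scaler0.
by exists 0; rewrite scaler0.
Qed.

Lemma torsion_bound_le x N N' X Y : (N <= N')%N ->
  torsion_bound x N X Y -> torsion_bound x N' X Y.
Proof.
move=> /subnK <- NP l u /NP xu; by rewrite exprD -scalerA xu scaler0.
Qed.

Lemma torsion_bound_family x (n : nat) (X_ : nat -> T) Y :
  (forall i, acc (H (X_ i) Y)) ->
  exists N, forall i, (i < n)%N -> torsion_bound x N (X_ i) Y.
Proof.
move=> accX; elim: n => [|n [N NP]]; first by exists 0%N.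
have [N' N'P] := acc_torsion_bound x (accX n).
exists (maxn N N') => i; rewrite ltnS leq_eqVlt => /predU1P[->|/NP].
  exact: torsion_bound_le (leq_maxr _ _) N'P.
exact: torsion_bound_le (leq_maxl _ _).
Qed.

(** For finite [m] the shifts of [X] are those of degrees [1] to [m], up to
    isomorphism; for infinite [m] only finitely many of the groups
    [Hom(Σ^j X, Y)] are nonzero. *)
Lemma uniform_torsion_bound m G : grading_pos m -> Zmod_graded m T ->
  is_generator G -> noetherian_module (Homgr act m G G) ->
  (forall X Y, acc (H X Y)) /\
  forall x X Y, exists N, forall j, torsion_bound x N (shiftz j X) Y.
Proof.
move=> m0 Tm genG noeG.
have accH X Y : acc (H X Y).
  apply: (hom_devissage (@hom_acc_serre _ _ act) translation_filter_all genG _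
    X Y 0) => j.
  case: m m0 Tm noeG => [n|] m0 Tm noeG; last exact: homgr_acc noeG _.
  have [i ni ij] := shiftz_mod j G m0 Tm.
  apply: (hom_class_iso (serre_additive (@hom_acc_serre _ _ act))
    (isomorphic_refl G) (isomorphic_sym ij)).
  by apply: homgr_acc noeG _; rewrite /degrees /= lez_nat ni.
split=> // x X Y; have addN N := torsion_bound_additive x N.
case: m m0 Tm noeG => [n|] m0 Tm noeG.
  have [N NP] := torsion_bound_family x n (fun i => @accH (shiftz i.+1%:Z X) Y).
  exists N => j; have [i ni ij] := shiftz_mod j X m0 Tm.
  apply: (hom_class_iso (addN N) (isomorphic_sym ij) (isomorphic_refl Y)).
  exact: NP.
have [b bP] := hom_devissage (@hom_zero_serre T) translation_filter_cobounded
  genG (homgr_bounded noeG) X Y.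
have [N1 N1P] := torsion_bound_family x b (fun i => @accH (shiftz i%:Z X) Y).
have [N2 N2P] :=
  torsion_bound_family x b (fun i => @accH (shiftz (- i%:Z) X) Y).
exists (maxn N1 N2) => j; have [bj l u _|] := leP b%:Z `|j|; first exact: bP.
rewrite -abszE ltz_nat => jb; have [j0|j0] := leP 0 j.
  rewrite -[j]gez0_abs //; apply: torsion_bound_le (leq_maxl _ _) _.
  exact: N1P.
rewrite -[j]opprK -[- j]ltz0_abs //; apply: torsion_bound_le (leq_maxr _ _) _.
exact: N2P.
Qed.

End TorsionBound.

(** * Towers of Koszul objects *)

Section KoszulObjects.
Variables (R : comPzRingType) (T : triangulated) (act : central_action R T).
Implicit Types (X Y Z : T) (r s x : R).
Local Notation H := (hom_mod act).
Hypothesis accH : forall X Y, acc (H X Y).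
Hypothesis torsionH :
  forall x X Y, exists N, forall j, torsion_bound act x N (shiftz j X) Y.

Lemma torsion_bound_gen1 G x N K :
  (forall j, torsion_bound act x N (shiftz j K) G) ->
  forall Z, gen1 G Z -> torsion_bound act x N K Z.
Proof.
move=> NP Z Zgen.
suff: forall j, torsion_bound act x N (shiftz j K) Z by move/(_ 0).
move: Z Zgen; apply: add_closure_min => [|_ -> //].
exact: (hom_class_target_stable (torsion_bound_additive act x N) K
  translation_filter_all).
Qed.

(** For [v] from [L] to [Z], the map [v ∘ q] is killed by [x ^+ (N' + N')],
    hence already by [x ^+ N']. *)
Lemma koszul_coghost G x K : exists N, forall N', (N <= N')%N ->
  forall L (q : hom K L), q ∘ act (x ^+ (N' + N')) K = 0 ->
  coghost G (q ∘ act (x ^+ N') K).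
Proof.
have [N NP] := torsionH x K G; exists N => N' NN' L q qx Z v Zgen.
rewrite compA -center_nat.
apply: (torsion_bound_le NN' (torsion_bound_gen1 NP Zgen) (l := (N' + N')%N)).
change (act (x ^+ (N' + N')) Z ∘ (v ∘ q) = 0).
by rewrite center_nat -compA qx compm0.
Qed.

(** [L] is the cone of [x ^+ (N + N)] on [K] and [f'] is [x ^+ N f] followed by
    the map to the cone, for [x] in [q] outside [p] and [N] large. *)
Lemma koszul_step G G' n (p q : set R) K (f : hom G K) :
  prime_ideal p -> prime_ideal q -> (p `<` q)%classic ->
  coghosts G' n f -> (forall r, act r K ∘ f = 0 -> p r) ->
  exists L (f' : hom G L), coghosts G' n.+1 f' /\
    forall r, act r L ∘ f' = 0 -> q r.
Proof.
move=> p_prime q_prime [pq qp] fn fp.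
have [x qx px] : exists2 x, q x & ~ p x.
  apply: contrapT => nqp; apply: qp => x qx; apply: contrapT => px.
  by apply: nqp; exists x.
have [N1 N1P] := koszul_coghost G' x K.
have [t tP] := annihilator_koszul_class (@accH G K) p_prime q_prime pq qx px fp.
pose N := (N1 + t).+1.
have [L [g [h gh]]] := dist_cone (act (x ^+ (N + N)) K).
exists L, (g ∘ act (x ^+ N) K ∘ f); split.
  exists K, f, (g ∘ act (x ^+ N) K); split=> //.
  by apply: N1P (dist_comp0 gh); rewrite /N -addnS leq_addr.
move=> s; rewrite -!compA compA center_nat -compA => sf.
have [m Em] := dist_lift gh sf; apply: (tP N _ s m Em).
by rewrite ltnS leq_addl.
Qed.

Lemma coghosts_of_prime_chain G G' n (p : nat -> set R) : prime_chain n p ->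
  (forall r, act r G = 0 -> p 0%N r) ->
  exists K (f : hom G K), coghosts G' n f /\ forall r, act r K ∘ f = 0 -> p n r.
Proof.
move=> [primep pS] p0; elim: n primep pS => [|n IHn] primep pS.
  by exists G, (idm G); split=> // r; rewrite compm1; exact: p0.
have [i ni|i ni|K [f [fn fp]]] := IHn.
- by apply: primep; exact: leqW.
- by apply: pS; exact: leqW.
exact: (koszul_step (primep n _) (primep n.+1 _) (pS n _) fn fp).
Qed.

End KoszulObjects.

(** * Prime chains and the dimension bound *)

Section AnnihilatorQuotient.
Variables (R : comPzRingType) (M : lmodType R).
Local Notation Q := (annihilator_quot M).
Local Notation pi r := (\pi_Q r)%qT.

Lemma prime_chain_lift n (p : nat -> set Q) : prime_chain n p ->
  exists q : nat -> set R, prime_chain n q /\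
    forall r, (forall u : M, r *: u = 0) -> q 0%N r.
Proof.
move=> [primep pS]; exists (fun i r => p i (pi r)).
have piD r s : pi (r + s) = pi r + pi s by exact: Quotient.pi_add.
have piM (r s : R) : pi (r * s) = pi r * pi s.
  exact: esym (quot_mul_pi M _ _).
have pi0 r : r \in annihilator M -> pi r = 0.
  move=> rM; have -> : pi r = pi 0 by apply: quot_piP; rewrite subr0.
  by apply: (addrI (pi 0)); rewrite -piD !addr0.
split; first split=> [i ni|i ni].
- have [p0 p1 pD pM] := primep i ni; split=> //.
  + by rewrite pi0 ?rpred0.
  + by move=> a u v pu pv; rewrite piD piM; exact: pD.
  + by move=> u v; rewrite piM; exact: pM.
- have [pp npp] := pS i ni; split=> [r|H]; first exact: pp.
  by apply: npp => x; elim/quotW: x => r; exact: H.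
move=> r /annihilatorP/pi0 ->; by have [] := primep 0%N isT.
Qed.

End AnnihilatorQuotient.

Theorem theorem1p16 (k : fieldType) (m : option nat) (m_pos : grading_pos m)
    (T : triangulated) (T_graded : Zmod_graded m T)
    (R : comPzRingType) (iota : {rmorphism k -> R})
    (R_ft : finite_type iota) (act : central_action R T)
    (G : T) (G_gen : is_generator G)
    (G_noeth : noetherian_module (Homgr act m G G)) :
  (module_dim (Homgr act m G G) <= Rdim T)%E.
Proof.
rewrite /Rdim; case: pselect => [ex|_]; last exact: leey.
case: ex_minnP => n /asboolP[G' genG'] _.
have lt_n d (p : nat -> set (annihilator_quot (Homgr act m G G))) :
    prime_chain d p -> (d < n)%N.
  move=> chain_p; rewrite ltnNge; apply/negP => nd.
  have [accH torsionH] := uniform_torsion_bound m_pos T_graded G_gen G_noeth.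
  have [q [chain_q q0]] := prime_chain_lift chain_p.
  (* If [n <= d], the first [n] inclusions of the chain already give a nonzero
     composite of [n] coghosts. *)
  have chain_n : prime_chain n q.
    have [primeq qS] := chain_q; split=> i ni.
      exact: primeq (leq_trans ni nd).
    exact: qS (leq_trans ni nd).
  have [r rG|K [f [fn fq]]] :=
    coghosts_of_prime_chain accH torsionH (G := G) G' chain_n.
    (* By centrality, what annihilates [id_G] annihilates every map from [G]. *)
    apply: q0 => h; apply: homc_ext => i /=.
    by rewrite center_nat rG compm0.
  have f0 : f = 0 by rewrite -[f]comp1m (coghost_lemma _ (genG' K) fn).
  have [_ q1 _ _] := chain_n.1 n (leqnn n).
  by apply: q1; apply: fq; rewrite f0 compm0.
rewrite /module_dim /krull_dim /supremum; case: ifP => _; first exact: leNye.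
case: xgetP => [y _ [_ ymin]|_]; last exact: leNye.
apply: ymin => _ [d [p chain_p] <-].
by rewrite lee_fin lerBrDr -PoszD addn1 lez_nat (lt_n _ _ chain_p).
Qed.
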